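(* Let $(L,[\cdot,\cdot])$ be a Lie algebra over $\mathbb{K}$ and let $\delta:L\to L$ be an invertible derivation of $(L,[\cdot,\cdot])$ such that its inverse $\delta^{-1}$ is also a derivation of $(L,[\cdot,\cdot])$. Then $(L,[\cdot,\cdot]_\delta)$, where $[x,y]_\delta=\delta([x,y])$ for all $x,y\in L$, is a Lie algebra.
   Context: $\mathbb{K}$ is a field of characteristic $0$. A derivation of $(L,[\cdot,\cdot])$ is a linear map $d:L\to L$ with $d([x,y])=[d x,y]+[x,d y]$ for all $x,y\in L$. *)

(* Defs.v *)
From mathcomp Require Import all_boot all_order all_algebra.

Set Implicit Arguments.
Unset Strict Implicit.
Unset Printing Implicit Defensive.

Import GRing.Theory.
Local Open Scope ring_scope.

(* Lie algebras of arbitrary (possibly infinite) dimension over a field K. *)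
Record is_lie_bracket (K : fieldType) (L : lmodType K) (br : L -> L -> L)
    : Prop := IsLieBracket {
  lie_bilinear : bilinear_for *:%R *:%R br;
  lie_alternating : forall x, br x x = 0;
  lie_jacobi : forall x y z,
    br x (br y z) + br y (br z x) + br z (br x y) = 0
}.

Record is_derivation (K : fieldType) (L : lmodType K) (br : L -> L -> L)
    (d : L -> L) : Prop := IsDerivation {
  derivation_linear : linear d;
  derivation_leibniz : forall x y, d (br x y) = br (d x) y + br x (d y)
}.

Definition deformed_bracket (K : fieldType) (L : lmodType K)
  (br : L -> L -> L) (delta : L -> L) (x y : L) : L := delta (br x y).

(* Main.v *)
Require Import Defs.
From mathcomp Require Import all_boot all_order all_algebra.

Set Implicit Arguments.
Unset Strict Implicit.
Unset Printing Implicit Defensive.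

Import GRing.Theory.
Local Open Scope ring_scope.

(** Write D for the derivation. Evaluating the Leibniz rule of D^-1 at
(D x, D y) gives the key identity [D x, D y] = D^2 [x, y]
([leibniz_inverse_square]). Applied once to the inner bracket and twice to the
outer one, it yields [D^2 x, [D y, D z]] = D^4 [x, [y, z]], so the cyclic sum
of the left-hand side vanishes by the Jacobi identity. As D is onto, the cyclic
sum of [D x, [y, z]] therefore vanishes for all x, y, z
([jacobi_twisted_outer]). Finally the Leibniz rule writes [x, D [y, z]] as
D [x, [y, z]] - [D x, [y, z]], and both cyclic sums are zero; applying D gives
the Jacobi identity of the deformed bracket. Bilinearity and alternation
carry over because D is linear. *)

Lemma linearD_of (K : fieldType) (U V : lmodType K) (f : U -> V) :
  linear f -> {morph f : x y / x + y}.
Proof. by move=> lin_f x y; have := lin_f 1 x y; rewrite !scale1r. Qed.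

Lemma linear0_of (K : fieldType) (U V : lmodType K) (f : U -> V) :
  linear f -> f 0 = 0.
Proof.
move=> lin_f; apply: (addrI (f 0)).
by rewrite -(linearD_of lin_f) !addr0.
Qed.

Section InvertibleDerivation.

Variables (K : fieldType) (L : lmodType K) (br : L -> L -> L).
Variables (delta delta_inv : L -> L).
Hypothesis (deltaK : cancel delta delta_inv).
Hypothesis (delta_invK : cancel delta_inv delta).
Hypothesis (der_delta : is_derivation br delta).
Hypothesis (der_delta_inv : is_derivation br delta_inv).

(** The Leibniz rule of the inverse at (delta x, delta y) has right-hand side
[x, delta y] + [delta x, y], which the Leibniz rule of delta recognizes as
delta [x, y]. *)
Lemma leibniz_inverse_square x y :
  br (delta x) (delta y) = delta (delta (br x y)).
Proof.
apply: (can_inj delta_invK).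
rewrite (derivation_leibniz der_delta_inv) !deltaK.
by rewrite (derivation_leibniz der_delta) addrC.
Qed.

Hypothesis (lieL : is_lie_bracket br).

(** By surjectivity each argument may be taken in the image of delta, where the
three terms become delta^4 of the terms of the Jacobi identity. *)
Lemma jacobi_twisted_outer x y z :
  br (delta x) (br y z) + br (delta y) (br z x) + br (delta z) (br x y) = 0.
Proof.
have deltaD := linearD_of (derivation_linear der_delta).
have delta0 := linear0_of (derivation_linear der_delta).
rewrite -(delta_invK x) -(delta_invK y) -(delta_invK z) !leibniz_inverse_square.
by rewrite -!deltaD (lie_jacobi lieL) !delta0.
Qed.

(** Applying delta to the Jacobi identity splits each term by the Leibniz rule;
the half in which delta hits the outer argument sums to zero by
[jacobi_twisted_outer]. *)
Lemma jacobi_twisted_inner x y z :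
  br x (delta (br y z)) + br y (delta (br z x)) + br z (delta (br x y)) = 0.
Proof.
have deltaD := linearD_of (derivation_linear der_delta).
have delta0 := linear0_of (derivation_linear der_delta).
have := congr1 delta (lie_jacobi lieL x y z).
rewrite delta0 !deltaD !(derivation_leibniz der_delta _ (br _ _)).
by rewrite [X in X + _]addrACA [LHS]addrACA jacobi_twisted_outer add0r.
Qed.

End InvertibleDerivation.

Theorem theorem2p3 (K : fieldType) (L : lmodType K) (br : L -> L -> L)
    (delta delta_inv : L -> L)
    (charK : [pchar K] =i pred0)
    (lieL : is_lie_bracket br)
    (deltaK : cancel delta delta_inv) (delta_invK : cancel delta_inv delta)
    (der_delta : is_derivation br delta)
    (der_delta_inv : is_derivation br delta_inv) :
  is_lie_bracket (deformed_bracket br delta).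
Proof.
have lin_delta := derivation_linear der_delta.
have deltaD := linearD_of lin_delta; have delta0 := linear0_of lin_delta.
have [lin_l lin_r] := lie_bilinear lieL.
rewrite /deformed_bracket; split=> [|x|x y z].
- split=> [y|x] a u v /=; first by rewrite (lin_l y a u v) lin_delta.
  by rewrite (lin_r x a u v) lin_delta.
- by rewrite (lie_alternating lieL) delta0.
rewrite -!deltaD.
by rewrite (jacobi_twisted_inner deltaK delta_invK der_delta der_delta_inv lieL).
Qed.
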